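(* Let $\delta\in\mathbb{C}$ and let $Z$ be a $2$-dimensional $\delta$-Zinbiel algebra over $\mathbb{C}$ with nonzero multiplication. Then $Z$ is isomorphic to one of the following algebras with basis $e_1,e_2$ (products of basis elements not listed are zero); moreover, each listed algebra is a $\gamma$-Zinbiel algebra for the indicated value of $\gamma$: - $\mathbf{A}_3$ ($\gamma$ arbitrary): $e_1e_1=e_2$; - $\mathbf{B}_2(0)$ ($\gamma=0$): $e_1e_2=e_1$.
   Context: An algebra means a complex vector space with a bilinear multiplication, not assumed associative. For $\delta\in\mathbb{C}$, a $\delta$-Zinbiel algebra is an algebra satisfying $x(yz)=\delta\big((xy)z-x(zy)\big)$ for all $x,y,z$. *)

(* Defs.v *)
From HB Require Import structures.
From mathcomp Require Import all_boot all_order all_algebra.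
From mathcomp Require Export sesquilinear.
From mathcomp Require Export reals complex.
Set Implicit Arguments.
Unset Strict Implicit.
Unset Printing Implicit Defensive.
Import GRing.Theory.
Local Open Scope ring_scope.

(* An algebra, not assumed associative or unital, is given by a K-module V
   together with a multiplication mul : {bilinear V -> V -> V}. *)

Definition zinbiel (K : fieldType) (delta : K) (V : lmodType K)
    (mul : {bilinear V -> V -> V}) : Prop :=
  forall x y z : V,
    mul x (mul y z) = delta *: (mul (mul x y) z - mul x (mul z y)).

Definition algebra_isomorphic (K : fieldType) (V W : lmodType K)
    (mulV : {bilinear V -> V -> V}) (mulW : {bilinear W -> W -> W}) : Prop :=
  exists f : {linear V -> W},
    bijective f /\ forall x y : V, f (mulV x y) = mulW (f x) (f y).

(* The multiplication on K^n whose products of canonical basis vectors are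
   prescribed by the table c (see table_mul_basis). *)
Definition table_mul (K : fieldType) (n : nat) (c : 'I_n -> 'I_n -> 'rV[K]_n)
    (u v : 'rV[K]_n) : 'rV[K]_n :=
  \sum_(i < n) \sum_(j < n) (u 0 i * v 0 j) *: c i j.

Lemma table_mul_bilinear (K : fieldType) (n : nat)
    (c : 'I_n -> 'I_n -> 'rV[K]_n) :
  bilinear_for *:%R *:%R (table_mul c : 'rV[K]_n -> 'rV[K]_n -> 'rV[K]_n).
Proof.
split=> [v a u w | u a v w]; rewrite /table_mul /=;
  rewrite scaler_sumr -big_split; apply: eq_bigr => i _ /=;
  rewrite scaler_sumr -big_split; apply: eq_bigr => j _ /=;
  by rewrite !mxE scalerA -scalerDl ?mulrDl ?mulrDr ?mulrA // (mulrC a).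
Qed.

HB.instance Definition _ (K : fieldType) (n : nat)
    (c : 'I_n -> 'I_n -> 'rV[K]_n) :=
  bilinear_isBilinear.Build K 'rV[K]_n 'rV[K]_n 'rV[K]_n *:%R *:%R
    (table_mul c) (table_mul_bilinear c).

Lemma table_mul_basis (K : fieldType) (n : nat)
    (c : 'I_n -> 'I_n -> 'rV[K]_n) (i j : 'I_n) :
  table_mul c (delta_mx 0 i) (delta_mx 0 j) = c i j.
Proof.
rewrite /table_mul (bigD1 i) //= (bigD1 j) //= !mxE !eqxx mulr1 scale1r.
rewrite big1 => [|k /negPf nkj]; last by rewrite !mxE nkj andbF mulr0 scale0r.
rewrite big1 ?addr0 // => k /negPf nki.
by rewrite big1 // => l _; rewrite !mxE nki andbF mul0r scale0r.
Qed.

(* The basis vectors e_1, e_2 are indexed by the elements 0, 1 of 'I_2. *)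
Definition e1 (K : fieldType) : 'rV[K]_2 := delta_mx 0 0.
Definition e2 (K : fieldType) : 'rV[K]_2 := delta_mx 0 1.

Definition A3 (K : fieldType) : {bilinear 'rV[K]_2 -> 'rV[K]_2 -> 'rV[K]_2} :=
  table_mul (fun i j => if (i == 0) && (j == 0) then e2 K else 0).

Definition B2_0 (K : fieldType) : {bilinear 'rV[K]_2 -> 'rV[K]_2 -> 'rV[K]_2} :=
  table_mul (fun i j => if (i == 0) && (j == 1) then e1 K else 0).

(* Main.v *)
Require Import Defs.
From HB Require Import structures.
From mathcomp Require Import all_boot all_order all_algebra.
From mathcomp Require Import sesquilinear reals complex.
From mathcomp Require Import ring.
Import GRing.Theory passmx.

Set Implicit Arguments.
Unset Strict Implicit.
Unset Printing Implicit Defensive.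

Local Open Scope ring_scope.
Local Open Scope complex_scope.

(** The identity on the triple (u,u,u) shows that [u u = a u] implies
[u u = 0], and over an algebraically closed field some line of a plane is
stable under squaring ([exists_square_eigenvector]); so some [e <> 0] has
[e e = 0].

When [delta <> 0], write the multiplication in a basis [e], [f].  The identity
on triples of basis vectors forces, one after the other, every remaining
structure constant to have square zero, except the coefficient of [e] in
[f f] ([zinbiel_square0_dim2]).

When [delta = 0] the identity says that left multiplications kill every
product.  Complete a nonzero product [w] to a basis [w], [f]; if some product
had a nonzero [f]-coordinate, left multiplications would kill [w] and [f], and
the multiplication would vanish.  Hence only [w f] and [f f] survive, both
multiples of [w] ([zinbiel0_dim2]).

Both cases thus end in one shape, [w f = a w] and [f f = c w], settled by
[normal_form]: a nonzero [a] leads to B2(0), and [a = 0] to A3. *)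

(** * Bases of two vectors and isomorphisms *)

Lemma table_mul_iso (K : fieldType) (V : vectType K)
    (mul : {bilinear V -> V -> V}) (n : nat) (X : n.-tuple V)
    (c : 'I_n -> 'I_n -> 'rV[K]_n) :
  basis_of {:V} X ->
  (forall i j : 'I_n, mul X`_i X`_j = \sum_(k < n) c i j 0 k *: X`_k) ->
  algebra_isomorphic mul (table_mul c).
Proof.
move=> basisX; have dimV := size_basis basisX; subst n => mulX.
exists (rVof X); split.
  by exists (vecof X); [exact: rVofK | exact: vecofK].
move=> x y; rewrite -{1}(rVofK basisX x) -{1}(rVofK basisX y).
rewrite {1}/vecof linear_sumlz linear_sum /table_mul.
apply: eq_bigr => i _; rewrite linear_sumr linear_sum; apply: eq_bigr => j _.
rewrite linearZl_LR linearZr_LR scalerA linearZ /= mulX.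
by congr (_ *: _); exact: vecofK.
Qed.

Section PairBasis.
Variables (K : fieldType) (V : vectType K).
Implicit Types (e f u v : V) (a b : K).

Lemma mem_span2 e f a b : a *: e + b *: f \in <<[:: e; f]>>%VS.
Proof. by rewrite rpredD // rpredZ // memv_span // !inE eqxx ?orbT. Qed.

Lemma basis2_coord e f : basis_of {:V} [:: e; f] ->
  forall v, exists a b, v = a *: e + b *: f.
Proof.
move=> ef v; have := coord_basis (X := [tuple e; f]) ef (memvf v).
by rewrite big_ord_recl big_ord1 => ->; do 2!eexists.
Qed.

Lemma basis2_eq0 e f : basis_of {:V} [:: e; f] ->
  forall a b, a *: e + b *: f = 0 -> a = 0 /\ b = 0.
Proof.
move=> /basis_free ef a b ab0.
have /freeP fr : free [tuple e; f] by [].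
have := fr (fun i => if i == 0 then a else b).
rewrite big_ord_recl big_ord1 /= => /(_ ab0) ab.
by split; [exact: ab 0 | exact: ab 1].
Qed.

Lemma basis2_change e f u v : basis_of {:V} [:: e; f] ->
  e \in <<[:: u; v]>>%VS -> f \in <<[:: u; v]>>%VS ->
  basis_of {:V} [:: u; v].
Proof.
move=> ef eP fP; rewrite basisEdim (size_basis (X := [tuple e; f]) ef) leqnn.
rewrite andbT -(span_basis ef); apply/span_subvP => w.
by rewrite !inE => /orP[] /eqP ->.
Qed.

Lemma basis2_neq0 e f : basis_of {:V} [:: e; f] -> e != 0 /\ f != 0.
Proof. by move/basis_free => ef; split; rewrite (free_not0 ef) ?inE ?eqxx ?orbT. Qed.

Lemma basis2_extend e : \dim {:V} = 2%N -> e != 0 ->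
  exists f, basis_of {:V} [:: e; f].
Proof.
move=> dimV e0.
have [|f _ fP] := @subvPn _ _ {:V}%VS <[e]>%VS _.
  by apply/negP => /dimvS; rewrite dimV dim_vline e0.
exists f; rewrite -(perm_basis (X := [:: f; e])); last first.
  by rewrite -[_ :: _]/([:: f] ++ [:: e]) perm_catC.
by rewrite basisEfree free_cons seq1_free e0 span_seq1 fP subvf dimV.
Qed.

End PairBasis.

(** * The two model algebras *)

Lemma A3E (K : fieldType) (x y : 'rV[K]_2) :
  A3 K x y = (x 0 0 * y 0 0) *: e2 K.
Proof. by rewrite /= /table_mul !(big_ord_recl, big_ord0) /= !scaler0 !addr0. Qed.

Lemma B2_0E (K : fieldType) (x y : 'rV[K]_2) :
  B2_0 K x y = (x 0 0 * y 0 1) *: e1 K.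
Proof.
rewrite /= /table_mul !(big_ord_recl, big_ord0) /= !scaler0 !addr0 !add0r.
by congr ((_ * y 0 _) *: _); apply/val_inj.
Qed.

Lemma A3_zinbiel (K : fieldType) (gamma : K) : zinbiel gamma (A3 K).
Proof.
by move=> x y z; rewrite !A3E !mxE /= !(mulr0, mul0r) !scale0r subr0 scaler0.
Qed.

Lemma B2_0_zinbiel (K : fieldType) : zinbiel 0 (B2_0 K).
Proof. by move=> x y z; rewrite !B2_0E !mxE /= !mulr0 !scale0r. Qed.

Section Models.
Variables (K : fieldType) (V : vectType K) (mul : {bilinear V -> V -> V}).
Implicit Types e f : V.

Lemma A3_iso e f : basis_of {:V} [:: e; f] ->
  mul e e = f -> mul e f = 0 -> mul f e = 0 -> mul f f = 0 ->
  algebra_isomorphic mul (A3 K).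
Proof.
move=> ef ee_ ef_ fe_ ff_; apply: (table_mul_iso (X := [tuple e; f]) ef).
by case=> [[|[|//]] ?] [[|[|//]] ?]; rewrite big_ord_recl big_ord1 /= !mxE /=
  ?scale0r ?scale1r ?addr0 ?add0r.
Qed.

Lemma B2_0_iso e f : basis_of {:V} [:: e; f] ->
  mul e e = 0 -> mul e f = e -> mul f e = 0 -> mul f f = 0 ->
  algebra_isomorphic mul (B2_0 K).
Proof.
move=> ef ee_ ef_ fe_ ff_; apply: (table_mul_iso (X := [tuple e; f]) ef).
by case=> [[|[|//]] ?] [[|[|//]] ?]; rewrite big_ord_recl big_ord1 /= !mxE /=
  ?scale0r ?scale1r ?addr0 ?add0r.
Qed.

(** If [a <> 0], rescaling [f] makes [w f = w], after which subtracting from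
[f] a multiple of [w] changes [f f] by a multiple of [w f = w] and can cancel
it.  If [a = 0], then [c <> 0] and [f], [c w] is the basis of A3. *)
Lemma normal_form w f (a c : K) : basis_of {:V} [:: w; f] ->
  mul w w = 0 -> mul f w = 0 -> mul w f = a *: w -> mul f f = c *: w ->
  (exists x y, mul x y != 0) ->
  algebra_isomorphic mul (A3 K) \/ algebra_isomorphic mul (B2_0 K).
Proof.
move=> wf ww_ fw_ wf_ ff_ mul_neq0.
have [a0|a0] := eqVneq a 0.
  left; have c0 : c != 0.
    apply/eqP => c0; case: mul_neq0 => x [y /eqP[]].
    have [p [q ->]] := basis2_coord wf x.
    have [r [s ->]] := basis2_coord wf y.
    rewrite !(linearDl, linearDr, linearZl_LR, linearZr_LR) /=.
    by rewrite ww_ fw_ wf_ ff_ a0 c0 !(scale0r, scaler0) !addr0.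
  apply: (@A3_iso f (c *: w)) => //.
  - apply: basis2_change wf _ _.
      by rewrite -[w in w \in _](scalerK c0) -[_ *: _]add0r -(scale0r f) mem_span2.
    by rewrite -[f in f \in _]scale1r -[_ *: _]addr0 -(scale0r (c *: w)) mem_span2.
  - by rewrite linearZr_LR /= fw_ scaler0.
  - by rewrite linearZl_LR /= wf_ a0 scale0r scaler0.
  - by rewrite linearZl_LR linearZr_LR /= ww_ !scaler0.
(* s solves g g = (c / a^2 - s) w = 0. *)
right; pose s := a^-2 * c; pose g := a^-1 *: f - s *: w.
apply: (@B2_0_iso w g) => //.
- apply: basis2_change wf _ _.
    by rewrite memv_span // inE eqxx.
  have -> : f = (a * s) *: w + a *: g; last exact: mem_span2.
  by rewrite /g scalerBr !scalerA divff // scale1r addrC subrK.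
- by rewrite linearBr !linearZr_LR /= ww_ wf_ scaler0 subr0 scalerA mulVf // scale1r.
- by rewrite linearBl !linearZl_LR /= ww_ fw_ !scaler0 subr0.
rewrite linearBr !linearBl !(linearZl_LR, linearZr_LR) /= ww_ fw_ wf_ ff_.
rewrite !scaler0 !subr0 !scalerA -scalerBl.
by apply/eqP; rewrite scaler_eq0 /s; apply/orP; left; apply/eqP; field.
Qed.

End Models.

(** * Classification in dimension two *)

Section Classification.
Variables (K : fieldType) (V : vectType K) (mul : {bilinear V -> V -> V}).
Variable delta : K.
Hypothesis mulP : zinbiel delta mul.
Implicit Types e f u : V.

(** With [u u = a u] both [(u u) u] and [u (u u)] equal [a^2 u], so the
identity on (u,u,u) reads [a^2 u = 0], whatever [delta] is. *)
Lemma square_eigen0 u a : mul u u = a *: u -> mul u u = 0.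
Proof.
move=> uu; have := mulP u u u.
rewrite {1 2 3}uu linearZr_LR linearZl_LR /= subrr scaler0 uu scalerA => /eqP.
by rewrite scaler_eq0 mulf_eq0 orbb => /orP[] /eqP ->; rewrite ?scale0r ?scaler0.
Qed.

(** For [delta = 0] every [u (v z)] vanishes, which confines all products to
a single line. *)
Lemma zinbiel0_dim2 : delta = 0 -> \dim {:V} = 2%N ->
  (exists x y, mul x y != 0) ->
  algebra_isomorphic mul (A3 K) \/ algebra_isomorphic mul (B2_0 K).
Proof.
move=> delta0 dimV mul_neq0; have [x [y xy0]] := mul_neq0.
have mul_prod u v z : mul u (mul v z) = 0 by rewrite mulP delta0 scale0r.
have [f wf] := basis2_extend dimV xy0.
set w := mul x y in wf xy0.
have mulw u : mul u w = 0 by exact: mul_prod.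
(* A product with a nonzero f-coordinate would give u f = 0 for every u,
   and x y would vanish. *)
have prod_w u v : exists a, mul u v = a *: w.
  have [a [b uv]] := basis2_coord wf (mul u v).
  have [b0|b0] := eqVneq b 0; first by exists a; rewrite uv b0 scale0r addr0.
  have mulf z : mul z f = 0.
    have := mul_prod z u v; rewrite uv linearDr !linearZr_LR /= mulw scaler0 add0r.
    by move/eqP; rewrite scaler_eq0 (negPf b0) => /eqP.
  case/eqP: xy0; rewrite /w; have [p [q ->]] := basis2_coord wf y.
  by rewrite linearDr !linearZr_LR /= mulw mulf !scaler0 addr0.
have [a wf_] := prod_w w f; have [c ff_] := prod_w f f.
exact: normal_form wf (mulw w) (mulw f) wf_ ff_ mul_neq0.
Qed.

(** A square-zero [e] turns the identity into equations on single structure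
constants: (f,e,e) gives [f e] in the line of [e], then (e,e,f) gives the same
for [e f].  The line is thus an ideal, and its one-dimensional quotient has no
idempotent by (f,f,f).  Finally (e,f,f) and (f,e,f) kill [e f] and [f e]. *)
Lemma zinbiel_square0_dim2 e f : delta != 0 -> basis_of {:V} [:: e; f] ->
  mul e e = 0 -> (exists x y, mul x y != 0) ->
  algebra_isomorphic mul (A3 K) \/ algebra_isomorphic mul (B2_0 K).
Proof.
move=> delta0 ef ee_ mul_neq0.
have sq0 (t : K) : t * t = 0 -> t = 0 by move/eqP; rewrite mulf_eq0 orbb => /eqP.
have deltaI (v : V) : delta *: v = 0 -> v = 0.
  by move/eqP; rewrite scaler_eq0 (negPf delta0) => /eqP.
have coord0 := basis2_eq0 ef.
have sq0e (t : K) : (t * t) *: e = 0 -> t = 0.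
  move/eqP; rewrite scaler_eq0 => /orP[/eqP/sq0 // | /eqP e0].
  by have [/eqP] := basis2_neq0 ef.
have [a [b ef_]] := basis2_coord ef (mul e f).
have [c [d fe_]] := basis2_coord ef (mul f e).
have [p [q ff_]] := basis2_coord ef (mul f f).
have d0 : d = 0.
  have := mulP f e e; rewrite ee_ linear0r fe_ subr0 => /esym/deltaI.
  rewrite linearDl !linearZl_LR /= ee_ scaler0 add0r fe_ scalerDr !scalerA.
  by case/coord0 => _ /sq0.
have b0 : b = 0.
  have := mulP e e f; rewrite ee_ linear0l sub0r fe_ d0 scale0r addr0.
  rewrite linearZr_LR /= ee_ scaler0 oppr0 scaler0.
  rewrite ef_ linearDr !linearZr_LR /= ee_ scaler0 add0r ef_ scalerDr !scalerA.
  by case/coord0 => _ /sq0.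
move: ef_ fe_; rewrite b0 d0 !scale0r !addr0 => ef_ fe_.
have q0 : q = 0.
  have fff_ : mul f (mul f f) = (p * c + q * p) *: e + (q * q) *: f.
    rewrite {1}ff_ linearDr !linearZr_LR /= fe_ ff_ scalerDr !scalerA addrA.
    by rewrite -scalerDl.
  have ff_f : mul (mul f f) f = (p * a + q * p) *: e + (q * q) *: f.
    rewrite {1}ff_ linearDl !linearZl_LR /= ef_ ff_ scalerDr !scalerA addrA.
    by rewrite -scalerDl.
  have := mulP f f f; rewrite fff_ ff_f opprD addrACA subrr addr0 -scalerBl.
  move/eqP; rewrite scalerA -subr_eq0 addrAC -scalerBl => /eqP.
  by case/coord0 => _ /sq0.
rewrite q0 scale0r addr0 in ff_.
have a0 : a = 0.
  have := mulP e f f; rewrite ff_ linearZr_LR /= ee_ scaler0 subr0.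
  rewrite ef_ linearZl_LR /= ef_ => /esym/deltaI.
  by rewrite scalerA => /sq0e.
have c0 : c = 0.
  have := mulP f e f; rewrite ef_ fe_ a0 scale0r linear0r linearZl_LR /= ef_.
  rewrite a0 scale0r scaler0 linearZr_LR /= fe_ sub0r => /esym/deltaI/eqP.
  rewrite oppr_eq0 scalerA => /eqP.
  exact: sq0e.
by apply: (normal_form ef ee_ _ ef_ ff_ mul_neq0); rewrite fe_ c0 scale0r.
Qed.

End Classification.

(** The slopes [t] for which the square of [e + t f] is proportional to it are
the roots of a polynomial of degree at most 3, whose cubic coefficient vanishes
only if [f f] is already proportional to [f]. *)
Lemma exists_square_eigenvector (K : closedFieldType) (V : vectType K)
    (mul : {bilinear V -> V -> V}) : \dim {:V} = 2%N ->
  exists2 u, u != 0 & exists a, mul u u = a *: u.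
Proof.
move=> dimV.
have [e e0] : exists e : V, e != 0.
  by exists (vpick {:V}); rewrite vpick0 -dimv_eq0 dimV.
have [f ef] := basis2_extend dimV e0.
have [a0 [b0 ee_]] := basis2_coord ef (mul e e).
have [a1 [b1 ef_]] := basis2_coord ef (mul e f + mul f e).
have [a2 [b2 ff_]] := basis2_coord ef (mul f f).
have [a2_0|a2_0] := eqVneq a2 0.
  exists f; first by case: (basis2_neq0 ef).
  by exists b2; rewrite ff_ a2_0 scale0r add0r.
(* In the basis, the square of e + t f is
   (a0 + a1 t + a2 t^2) e + (b0 + b1 t + b2 t^2) f; it is proportional to
   e + t f when t (a0 + a1 t + a2 t^2) = b0 + b1 t + b2 t^2, a cubic equation
   made monic by dividing by a2. *)
have [t] := @GRing.solve_monicpoly K 3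
  (nth 0 [:: b0 / a2; (b1 - a0) / a2; (b2 - a1) / a2]) isT.
rewrite !big_ord_recl big_ord0 /= /bump /= => t3.
exists (e + t *: f).
  apply/eqP; rewrite -[e]scale1r => /(basis2_eq0 ef) [/eqP].
  by rewrite oner_eq0.
exists (a0 + t * a1 + t ^+ 2 * a2).
have slope : (a0 + t * a1 + t ^+ 2 * a2) * t = b0 + t * b1 + t ^+ 2 * b2.
  have -> : (a0 + t * a1 + t ^+ 2 * a2) * t = a0 * t + a1 * t ^+ 2 + a2 * t ^+ 3.
    by ring.
  by rewrite t3; field.
rewrite scalerDr scalerA slope.
rewrite linearDl !linearDr !(linearZl_LR, linearZr_LR) /=.
rewrite !scalerDl -!(scalerA t) expr2 -!(scalerA (t * t)) scalerA.
set A := mul e e; set D := mul f f; set B := mul e f; set C := mul f e.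
have -> : A + t *: B + (t *: C + (t * t) *: D)
        = A + t *: (B + C) + (t * t) *: D by rewrite scalerDr !addrA.
rewrite /A /D ee_ ff_ ef_ !scalerDr.
by rewrite (addrACA (a0 *: e)) (addrACA (a0 *: e + _)).
Qed.

Unset Implicit Arguments.

Theorem theorem35 (R : realType) :
  (forall (delta : R[i]) (Z : vectType R[i]) (mul : {bilinear Z -> Z -> Z}),
     \dim {:Z} = 2%N ->
     zinbiel delta mul ->
     (exists x y : Z, mul x y != 0) ->
     algebra_isomorphic mul (A3 R[i]) \/ algebra_isomorphic mul (B2_0 R[i]))
  /\ (forall gamma : R[i], zinbiel gamma (A3 R[i]))
  /\ zinbiel 0 (B2_0 R[i]).
Proof.
split; last by split; [exact: A3_zinbiel | exact: B2_0_zinbiel].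
move=> delta Z mul dimZ mulP mul_neq0.
have [delta0|delta0] := eqVneq delta 0; first exact: zinbiel0_dim2 mulP _ _ _.
have [e e0 [a ee]] := exists_square_eigenvector mul dimZ.
have [f ef] := basis2_extend dimZ e0.
apply: (zinbiel_square0_dim2 mulP delta0 ef _ mul_neq0).
exact: (square_eigen0 mulP ee).
Qed.
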